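(* For $\lambda\in[1/2,2]$, $\nu\ge\lambda$ with $(\lambda,\nu)\ne(\tfrac12,\tfrac12)$, and $x>0$, $$\frac{K_{\nu+1}(x)}{K_\nu(x)}>B\Big(\nu+\lambda,\nu-\lambda,\sqrt{c_\nu^{(K)}(\lambda)},x\Big),\qquad\text{where}\qquad c_\nu^{(K)}(\lambda)=\frac{\nu-\lambda}{\nu+\lambda-2\sqrt{2\lambda}+1}.$$
   Context: $K_\nu$ denotes the modified Bessel function of the second kind of real order $\nu$, and $B(\alpha,\beta,\gamma,x)=\dfrac{\alpha+\sqrt{\beta^2+\gamma^2x^2}}{x}$. *)

(* Defs.v *)
From HB Require Import structures.
From mathcomp Require Import all_boot all_order all_algebra.
From mathcomp Require Import all_classical all_reals all_analysis.
Set Implicit Arguments.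
Unset Strict Implicit.
Unset Printing Implicit Defensive.
Import Order.TTheory GRing.Theory Num.Theory.
Import numFieldNormedType.Exports.

Local Open Scope classical_set_scope.
Local Open Scope ring_scope.

Definition cosh {R : realType} (t : R) : R := (expR t + expR (- t)) / 2.

(* K_nu(x) = \int_0^oo exp (- x cosh t) cosh (nu t) dt (DLMF 10.32.9), for
   every real order nu, integer or not, and x > 0.  The integrand is positive
   and integrable exactly when x > 0, so for such x the value is the genuine
   integral; for x <= 0 it is the junk value 0 = fine +oo. *)
Definition besselK {R : realType} (nu x : R) : R :=
  \int[@lebesgue_measure R]_(t in `[0, +oo[%classic)
    (expR (- (x * cosh t)) * cosh (nu * t)).

Definition ratio_bound {R : realType} (alpha beta gamma x : R) : R :=
  (alpha + Num.sqrt (beta ^+ 2 + gamma ^+ 2 * x ^+ 2)) / x.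

(* The denominator equals (nu - lambda) + (sqrt (2 lambda) - 1)^2, which for
   nu >= lambda > 0 vanishes only at lambda = nu = 1/2. *)
Definition besselK_coef {R : realType} (nu lambda : R) : R :=
  (nu - lambda) / (nu + lambda - 2 * Num.sqrt (2 * lambda) + 1).

(* Main.v *)
Require Import Defs.
From HB Require Import structures.
From mathcomp Require Import all_boot all_order all_algebra.
From mathcomp Require Import all_classical all_reals all_analysis.
From mathcomp Require Import measurable_realfun ring lra.
Import Order.TTheory GRing.Theory Num.Theory.
Import numFieldNormedType.Exports.
Local Open Scope classical_set_scope.
Local Open Scope ring_scope.

Local Notation "\int0y_ t F" :=
  (\int[@lebesgue_measure _]_(t in `[0%R, +oo[) F)%R
  (at level 36, t name, F at level 36, format "\int0y_ t  F").
Local Notation integrable0y f :=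
  ((@lebesgue_measure _).-integrable `[0%R, +oo[ (EFin \o f)).

(** Put y = x K_{nu+1}(x) / K_nu(x).  The two first-order relations
    K_nu' = (nu/x) K_nu - K_{nu+1} and K_{nu+1}' = - K_nu - ((nu+1)/x) K_{nu+1}
    turn into the Riccati equation x y' = y^2 - 2 nu y - x^2, and the claim is
    that y lies above B = nu + lambda + s, where s = sqrt (d^2 + c x^2),
    d = nu - lambda and c is the given coefficient.

    With m = sqrt (2 lambda), so that c = d / (d + (m - 1)^2), the defect of B
    in the Riccati equation is a perfect square up to a positive factor:

      x B' - (B^2 - 2 nu B - x^2) = (s - d) (1 - (m - 1) s/d)^2 (d/s) >= 0,

    and it vanishes at one point at most, because s increases strictly with x.
    This identity is what singles out the value of c.

    Instead of comparing y with B directly, one follows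
    P = B K_nu - x K_{nu+1}, which satisfies a linear equation,
    P' = ((B - nu)/x) P + (defect) K_nu / x.  Dividing by the explicit
    integrating factor exp h, with h' = (B - nu)/x >= 0, gives a strictly
    increasing function P exp (- h).  It is bounded above by
    B K_nu exp (- h), which tends to 0 at infinity because K_nu decays
    exponentially while B grows at most linearly.  A strictly increasing
    function whose upper bound tends to 0 is negative, so B K_nu < x K_{nu+1}
    ([ratio_gt_supersolution], [besselK_gt_sqrt]).  When nu = lambda the bound
    degenerates to B = 2 nu, with defect x^2, and the same comparison applies
    ([besselK_gt_2nu]).

    The relations for K_nu come from the integral representation:
    differentiation under the integral sign gives
    K_nu' = - (K_{nu+1} + K_{nu-1})/2 ([is_derive_besselK]), and integrating
    the derivative of exp (- x cosh t) sinh (nu t) over the half-line gives the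
    three-term recurrence ([besselK_recurrence]).  All the integrals converge
    because the integrands are O(exp (- t)). *)

(** * Integrals over the half-line of functions bounded by M exp (- t) *)

Lemma ge0_half_line (R : realType) (t : R) :
  (`[0, +oo[%classic : set R) t -> 0 <= t.
Proof. by rewrite /= in_itv/= andbT. Qed.

Lemma is_derive_continuous (R : realType) (f : R -> R) (x df : R) :
  is_derive x 1 f df -> f z @[z --> x] --> f x.
Proof.
by move=> fx; apply/differentiable_continuous/derivable1_diffP/ex_derive.
Qed.

Lemma is_derive_expRN (R : realType) (t : R) :
  is_derive t 1 (fun s => - expR (- s)) (expR (- t)).
Proof. by apply: is_derive_eq; rewrite /GRing.scale/=; ring. Qed.

Lemma integral_expRN (R : realType) :
  (\int[@lebesgue_measure R]_(t in `[0%R, +oo[) (expR (- t))%:E = 1)%E.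
Proof.
rewrite (@ge0_continuous_FTC2y R _ (fun t => - expR (- t)) 0 0).
- by rewrite oppr0 expR0 sub0e -EFinN opprK.
- by move=> *; exact: expR_ge0.
- apply: continuous_subspaceT => t.
  by apply: differentiable_continuous; exact/derivable1_diffP.
- by rewrite -[X in _ --> X]oppr0; apply: cvgN; exact: cvgr_expR.
- by move=> t _; apply: ex_derive; exact: is_derive_expRN.
- apply: cvg_at_right_filter.
  exact: (is_derive_continuous _ _ _ _ (is_derive_expRN R 0)).
- move=> t _; rewrite derive1E; apply: derive_val; exact: is_derive_expRN.
Qed.

Lemma integrable_expRN (R : realType) (M : R) :
  integrable0y (fun t => M * expR (- t)).
Proof.
have -> : EFin \o (fun t : R => M * expR (- t)) =
  (fun t => (M%:E * (expR (- t))%:E)%E) by [].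
apply: integrableZl => //.
apply/integrableP; split.
  apply/measurable_EFinP; apply: measurable_funTS.
  apply: continuous_measurable_fun => t.
  by apply: differentiable_continuous; exact/derivable1_diffP.
under eq_integral do rewrite gee0_abs ?lee_fin ?expR_ge0//.
by rewrite integral_expRN ltry.
Qed.

Lemma integrable_le_expRN (R : realType) (f : R -> R) (M : R) :
  continuous f -> (forall t, 0 <= t -> `|f t| <= M * expR (- t)) ->
  integrable0y f.
Proof.
move=> cf fM; apply: (le_integrable _ _ _ (integrable_expRN R M)) => //.
  apply/measurable_EFinP; apply: measurable_funTS.
  exact: continuous_measurable_fun.
move=> t /ge0_half_line t0 /=.
by rewrite lee_fin (le_trans (fM _ t0))// ler_norm.
Qed.

Lemma cvg0_le_expRN (R : realType) (f : R -> R) (M : R) :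
  (forall t, 0 <= t -> `|f t| <= M * expR (- t)) -> f t @[t --> +oo] --> 0.
Proof.
move=> fM; apply: norm_cvg0.
apply: (@squeeze_cvgr _ _ _ _ (fun=> 0) (fun t => M * expR (- t))).
- near=> t; rewrite normr_ge0 fM//; near: t; exact: nbhs_pinfty_ge.
- exact: cvg_cst.
- by rewrite -[X in _ --> X](mulr0 M); apply: cvgMr; exact: cvgr_expR.
Unshelve. all: by end_near. Qed.

(** The fundamental theorem on a half-line is available for nonnegative
    integrands; adding M exp (- t), whose integral is M, to g brings it to that
    case. *)
Lemma Rintegral_derive_half_line (R : realType) (G g : R -> R) (M : R) :
  (forall t : R, is_derive t 1 G (g t)) -> continuous g ->
  (forall t, 0 <= t -> `|g t| <= M * expR (- t)) ->
  (G t @[t --> +oo] --> 0) ->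
  \int0y_t (g t) = - G 0.
Proof.
move=> dG cg gM G0.
have dF (t : R) : is_derive t 1 (fun s => G s + M * - expR (- s))
                     (g t + M * expR (- t)).
  have := is_derive_expRN R t => d1.
  apply: is_deriveD; exact: is_deriveZ.
have ce : continuous (fun t : R => M * expR (- t)).
  by move=> t; apply: differentiable_continuous; exact/derivable1_diffP.
have : \int0y_t (g t + M * expR (- t)) = 0 - (G 0 + M * - expR (- 0)).
  apply: (@Rintegral_ge0_continuous_FTC2y R _
    (fun s => G s + M * - expR (- s)) 0 0) => //.
  - move=> t /gM; rewrite ler_norml => /andP[+ _]; lra.
  - apply: continuous_subspaceT => t; apply: cvgD; [exact: cg|exact: ce].
  - rewrite -[X in _ --> X]addr0; apply: cvgD => //.
    rewrite -[X in _ --> X](mulr0 M) -[X in _ * X]oppr0.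
    apply: cvgMr; apply: cvgN; exact: cvgr_expR.
  - apply: cvg_at_right_filter.
    exact: (is_derive_continuous _ _ _ _ (dF 0)).
  - by move=> t _; rewrite derive1E; apply: derive_val.
rewrite RintegralD//; last 2 first.
- exact: (integrable_le_expRN _ _ _ cg gM).
- exact: integrable_expRN.
rewrite RintegralZl//; last first.
  have := integrable_expRN R 1; congr (_.-integrable _ _).
  by apply/funext => t /=; rewrite mul1r.
rewrite [X in M * X]/Rintegral integral_expRN/= oppr0 expR0; lra.
Qed.

(** * Hyperbolic functions and the integrand of K *)

Definition sinh {R : realType} (t : R) : R := (expR t - expR (- t)) / 2.

Lemma cosh_ge1 (R : realType) (t : R) : 1 <= cosh t.
Proof.
rewrite /cosh expRN; have := expR_gt0 t; set a := expR t => a0.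
rewrite ler_pdivlMr// mul1r -subr_ge0.
have -> : a + a^-1 - 2 = (a - 1) ^+ 2 / a by field; rewrite gt_eqF.
by rewrite divr_ge0 ?sqr_ge0// ltW.
Qed.

Lemma cosh_gt0 (R : realType) (t : R) : 0 < cosh t.
Proof. exact: lt_le_trans (cosh_ge1 R t). Qed.

Lemma normr_sinh_le_cosh (R : realType) (t : R) : `|sinh t| <= cosh t.
Proof.
rewrite /sinh /cosh ler_norml.
by have := expR_gt0 t; have := expR_gt0 (- t); lra.
Qed.

(** A quadratic lower bound suffices for x cosh t to beat any linear
    function of t. *)
Lemma cosh_ge_sqr (R : realType) (t : R) : 0 <= t -> t ^+ 2 / 4 <= cosh t.
Proof.
move=> t0; have := @expR_ge1Dxn R t 1 t0; have := expR_gt0 (- t).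
by rewrite /cosh !factS fact0 !muln1 => ? ?; lra.
Qed.

Lemma cosh_le_expR (R : realType) (a t : R) :
  0 <= t -> cosh (a * t) <= expR (`|a| * t).
Proof.
move=> t0; rewrite /cosh.
have h (b : R) : b <= `|a| -> expR (b * t) <= expR (`|a| * t).
  by move=> ba; rewrite ler_expR ler_wpM2r.
have h1 := h a (ler_norm _); have := h (- a).
by rewrite -normrN ler_norm mulNr normrN => /(_ isT) h2; lra.
Qed.

Lemma is_derive_cosh (R : realType) (t : R) : is_derive t 1 cosh (sinh t).
Proof.
rewrite /cosh /sinh; apply: is_derive_eq.
by rewrite /GRing.scale/=; field.
Qed.

Lemma is_derive_sinh (R : realType) (t : R) : is_derive t 1 sinh (cosh t).
Proof.
rewrite /cosh /sinh; apply: is_derive_eq.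
by rewrite /GRing.scale/=; field.
Qed.

Lemma mul_cosh_cosh (R : realType) (a t : R) :
  cosh t * cosh (a * t) = (cosh ((a + 1) * t) + cosh ((a - 1) * t)) / 2.
Proof.
rewrite /cosh !mulrDl !mulNr !mul1r !opprD opprK !expRD; by field.
Qed.

Lemma mul_sinh_sinh (R : realType) (a t : R) :
  sinh t * sinh (a * t) = (cosh ((a + 1) * t) - cosh ((a - 1) * t)) / 2.
Proof.
rewrite /cosh /sinh !mulrDl !mulNr !mul1r !opprD opprK !expRD; by field.
Qed.

Definition besselK_kernel {R : realType} (a x t : R) : R :=
  expR (- (x * cosh t)) * cosh (a * t).

Lemma besselK_kernel_gt0 (R : realType) (a x t : R) : 0 < besselK_kernel a x t.
Proof. by rewrite mulr_gt0 ?expR_gt0 ?cosh_gt0. Qed.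

(** The exponent is the maximum over t of (|a| + 1) t - x t^2 / 4. It makes
    the integrand O(exp (- t)). *)
Definition besselK_decay {R : realType} (a x : R) : R :=
  expR ((`|a| + 1) ^+ 2 / x).

Lemma besselK_kernel_le (R : realType) (a x t : R) : 0 < x -> 0 <= t ->
  besselK_kernel a x t <= besselK_decay a x * expR (- t).
Proof.
move=> x0 t0; rewrite /besselK_kernel /besselK_decay.
apply: (@le_trans _ _ (expR (- (x * cosh t)) * expR (`|a| * t))).
  by rewrite ler_wpM2l ?expR_ge0// cosh_le_expR.
rewrite -!expRD ler_expR.
have := cosh_ge_sqr R t t0; set k := `|a| => ct.
have h : x * (t ^+ 2 / 4) <= x * cosh t by rewrite ler_pM2l.
suff : 0 <= (k + 1) ^+ 2 / x - t - k * t + x * (t ^+ 2 / 4) by lra.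
have -> : (k + 1) ^+ 2 / x - t - k * t + x * (t ^+ 2 / 4) =
  (x * t / 2 - (k + 1)) ^+ 2 / x by field; rewrite gt_eqF.
by rewrite divr_ge0 ?sqr_ge0// ltW.
Qed.

Lemma is_derive_cosh_comp (R : realType) (a t : R) :
  is_derive t 1 (fun s => cosh (a * s)) (a * sinh (a * t)).
Proof.
have d1 := is_derive_cosh R (a * t).
have d2 : is_derive t 1 (fun s : R => a * s) a.
  by apply: is_derive_eq; rewrite /GRing.scale/= mulr1.
rewrite mulrC; exact: (@is_derive1_comp R cosh (fun s => a * s)).
Qed.

Lemma is_derive_sinh_comp (R : realType) (a t : R) :
  is_derive t 1 (fun s => sinh (a * s)) (a * cosh (a * t)).
Proof.
have d1 := is_derive_sinh R (a * t).
have d2 : is_derive t 1 (fun s : R => a * s) a.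
  by apply: is_derive_eq; rewrite /GRing.scale/= mulr1.
rewrite mulrC; exact: (@is_derive1_comp R sinh (fun s => a * s)).
Qed.

Lemma is_derive_expR_cosh (R : realType) (x t : R) :
  is_derive t 1 (fun s => expR (- (x * cosh s)))
            (- (x * sinh t * expR (- (x * cosh t)))).
Proof.
have d1 := is_derive_cosh R t.
by apply: is_derive_eq; rewrite /GRing.scale/=; ring.
Qed.

Lemma continuous_besselK_kernel (R : realType) (a x : R) :
  continuous (besselK_kernel a x).
Proof.
move=> t; rewrite /besselK_kernel; apply: cvgM.
  exact: (is_derive_continuous _ _ _ _ (is_derive_expR_cosh R x t)).
exact: (is_derive_continuous _ _ _ _ (is_derive_cosh_comp R a t)).
Qed.

Lemma integrable_besselK_kernel (R : realType) (a x : R) : 0 < x ->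
  integrable0y (besselK_kernel a x).
Proof.
move=> x0; apply: (@integrable_le_expRN R _ (besselK_decay a x)).
  exact: continuous_besselK_kernel.
move=> t t0; rewrite ger0_norm; first exact: besselK_kernel_le.
exact/ltW/besselK_kernel_gt0.
Qed.

(** * Positivity, recurrence, derivative and decay of K *)

(** Since u <= exp u, the integrand dominates half of
    2 x sinh t exp (- 2 x cosh t), the derivative of - exp (- 2 x cosh t), whose
    integral over the half-line is exp (- 2 x) > 0. *)
Lemma besselK_gt0 (R : realType) (a x : R) : 0 < x -> 0 < besselK a x.
Proof.
move=> x0.
pose g (t : R) := 2 * x * sinh t * expR (- (2 * x * cosh t)).
have gle (t : R) : `|g t| <= 2 * besselK_kernel a x t.
  rewrite /g normrM (ger0_norm (expR_ge0 _)) normrM.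
  rewrite (@gtr0_norm _ (2 * x)) ?mulr_gt0//.
  have h1 : x * `|sinh t| <= expR (x * cosh t).
    apply: le_trans (_ : 1 + x * cosh t <= _); last exact: expR_ge1Dx.
    have := normr_sinh_le_cosh R t; rewrite -(ler_pM2l x0); lra.
  have -> : expR (- (2 * x * cosh t)) =
      expR (- (x * cosh t)) / expR (x * cosh t).
    by rewrite -expRN -expRD; congr expR; ring.
  rewrite /besselK_kernel.
  have e1 := expR_gt0 (- (x * cosh t)); have e2 := expR_gt0 (x * cosh t).
  apply: (@le_trans _ _ (2 * expR (- (x * cosh t)))).
    have -> : 2 * x * `|sinh t| * (expR (- (x * cosh t)) / expR (x * cosh t)) =
      2 * expR (- (x * cosh t)) * ((x * `|sinh t|) / expR (x * cosh t)).
      by field; rewrite gt_eqF.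
    by rewrite ler_piMr// ler_pdivrMr// mul1r.
  rewrite ler_pM2l// ler_peMr ?cosh_ge1// ltW//.
have cg : continuous g.
  move=> t; have d1 := is_derive_sinh R t; have d2 := is_derive_cosh R t.
  apply: cvgM; last first.
    exact: (is_derive_continuous _ _ _ _ (is_derive_expR_cosh R (2 * x) t)).
  apply: cvgM; first exact: cvg_cst.
  exact: (is_derive_continuous _ _ _ _ d1).
have gM (t : R) : 0 <= t -> `|g t| <= 2 * besselK_decay a x * expR (- t).
  move=> t0; apply: le_trans (gle t) _.
  by rewrite -mulrA ler_pM2l// besselK_kernel_le.
have Ig : \int0y_t (- g t) = - expR (- (2 * x)).
  have dG := is_derive_expR_cosh R (2 * x).
  have -> : 2 * x = 2 * x * cosh 0 by rewrite /cosh oppr0 expR0 divff// mulr1.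
  apply: (@Rintegral_derive_half_line R (fun t => expR (- (2 * x * cosh t))) _
     (2 * besselK_decay a x) dG).
  - by move=> t; apply: cvgN; exact: cg.
  - by move=> t t0; rewrite normrN gM.
  - have x20 : 0 < 2 * x by lra.
    apply: (@cvg0_le_expRN R _ (besselK_decay 0 (2 * x))) => t t0.
    rewrite ger0_norm ?expR_ge0//.
    apply: le_trans (besselK_kernel_le R 0 (2 * x) t x20 t0).
    by rewrite /besselK_kernel mul0r {3}/cosh oppr0 expR0 divff// mulr1.
have : \int0y_t (g t) <= \int0y_t (2 * besselK_kernel a x t).
  apply: le_Rintegral => //.
  - exact: integrable_le_expRN cg gM.
  - apply: (@integrable_le_expRN R _ (2 * besselK_decay a x)).
      move=> t; apply: cvgM; first exact: cvg_cst.
      exact: continuous_besselK_kernel.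
    move=> t t0; rewrite ger0_norm; last first.
      by rewrite mulr_ge0// ltW// besselK_kernel_gt0.
    by rewrite -mulrA ler_pM2l// besselK_kernel_le.
  - by move=> t _; apply: le_trans (gle t); exact: ler_norm.
rewrite RintegralZl//; last exact: integrable_besselK_kernel.
have -> : \int0y_t (g t) = expR (- (2 * x)).
  rewrite -[RHS]opprK -Ig -mulN1r -RintegralZl//.
    by apply: eq_Rintegral => t _; rewrite mulN1r opprK.
  apply: (@integrable_le_expRN R _ (2 * besselK_decay a x)).
    by move=> t; apply: cvgN; exact: cg.
  by move=> t t0; rewrite normrN gM.
rewrite -/(besselK a x); have := expR_gt0 (- (2 * x)); lra.
Qed.

(** The function exp (- x cosh t) sinh (a t) vanishes at 0 and at
    infinity, so its derivative has integral zero; the product formula for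
    sinh t sinh (a t) turns that derivative into the three integrands. *)
Lemma besselK_recurrence (R : realType) (a x : R) : 0 < x ->
  x * (besselK (a + 1) x - besselK (a - 1) x) = 2 * a * besselK a x.
Proof.
move=> x0.
pose k := @besselK_kernel R.
pose g (t : R) := a * k a x t - x / 2 * (k (a + 1) x t - k (a - 1) x t).
have Ik b := integrable_besselK_kernel R b x x0.
have kM b (t : R) : 0 <= t -> `|k b x t| <= besselK_decay b x * expR (- t).
  move=> t0; rewrite gtr0_norm ?besselK_kernel_gt0//.
  exact: besselK_kernel_le.
have cg : continuous g.
  move=> t; apply: cvgB.
    by apply: cvgM; [exact: cvg_cst|exact: continuous_besselK_kernel].
  apply: cvgM; first exact: cvg_cst.
  by apply: cvgB; exact: continuous_besselK_kernel.
have dG (t : R) :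
    is_derive t 1 (fun s => expR (- (x * cosh s)) * sinh (a * s)) (g t).
  have d1 := is_derive_expR_cosh R x t; have d2 := is_derive_sinh_comp R a t.
  apply: is_derive_eq; rewrite /GRing.scale/= /g /k /besselK_kernel -mulrBr.
  transitivity (expR (- (x * cosh t)) *
                (a * cosh (a * t) - x * (sinh t * sinh (a * t)))); first by ring.
  by rewrite mul_sinh_sinh; field.
pose M := `|a| * besselK_decay a x + x / 2 * besselK_decay (a + 1) x
          + x / 2 * besselK_decay (a - 1) x.
have gM (t : R) : 0 <= t -> `|g t| <= M * expR (- t).
  move=> t0; rewrite /g /M !mulrDl.
  apply: le_trans (ler_normB _ _) _; rewrite -addrA.
  apply: lerD; first by rewrite normrM -mulrA ler_wpM2l// kM.
  have x20 : 0 < x / 2 by lra.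
  rewrite normrM (gtr0_norm x20) -!(mulrA (x / 2)) -mulrDr ler_pM2l//.
  apply: le_trans (ler_normB _ _) _.
  by apply: lerD; exact: kM.
have : \int0y_t (g t) = 0.
  rewrite (Rintegral_derive_half_line R _ _ M dG cg gM).
    by rewrite mulr0 /sinh oppr0 subrr mul0r mulr0 oppr0.
  apply: (@cvg0_le_expRN R _ (besselK_decay a x)) => t t0.
  apply: le_trans (besselK_kernel_le R a x t x0 t0).
  rewrite normrM (ger0_norm (expR_ge0 _)) ler_wpM2l ?expR_ge0//.
  exact: normr_sinh_le_cosh.
have Zint (c : R) b : integrable0y (fun t => c * k b x t).
  exact: (integrableZl _ _ (Ik b)).
have I2 : integrable0y (fun t => k (a + 1) x t - k (a - 1) x t).
  exact: (integrableB _ (Ik (a + 1)) (Ik (a - 1))).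
rewrite /g RintegralB//; last exact: (integrableZl _ _ I2).
rewrite !RintegralZl// RintegralB//.
rewrite /k -!/(besselK _ _) => h; lra.
Qed.

(** On ]x/2, x + 1[ the derivative in x of the integrand is dominated by
    its absolute value at x/2, and cosh t cosh (a t) is a sum of two cosh. *)
Lemma is_derive_besselK (R : realType) (a x : R) : 0 < x ->
  is_derive x 1 (besselK a) (- (besselK (a + 1) x + besselK (a - 1) x) / 2).
Proof.
move=> x0.
pose k := @besselK_kernel R.
have kint (b y : R) := @integrable_besselK_kernel R b y.
have d1k (y t : R) : is_derive y 1 (fun z => k a z t) (- (cosh t * k a y t)).
  rewrite /k /besselK_kernel; apply: is_derive_eq.
  by rewrite /GRing.scale/=; ring.
have dkE (y t : R) : partial1of2 (k a) y t =
    - 2^-1 * (k (a + 1) y t + k (a - 1) y t).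
  rewrite /partial1of2 derive1E; have /@derive_val -> := d1k y t.
  rewrite /k /besselK_kernel mulrCA mul_cosh_cosh; by field.
have kD : forall b y, 0 < y ->
    integrable0y (fun t => k (b + 1) y t + k (b - 1) y t).
  move=> b y y0; exact: (integrableD _ (kint (b + 1) y y0) (kint (b - 1) y y0)).
have := @cvg_differentiation_under_integral R _ _ (@lebesgue_measure R) (k a)
  `[0, +oo[ _ x (x / 2) (x + 1) _ _ _
  (fun t => 2^-1 * (k (a + 1) (x / 2) t + k (a - 1) (x / 2) t)).
have -> : \int0y_t (partial1of2 (k a) x t) =
    - (besselK (a + 1) x + besselK (a - 1) x) / 2.
  under eq_Rintegral do rewrite dkE.
  rewrite RintegralZl//; last exact: kD.
  rewrite RintegralD//; try exact: kint.
  by rewrite -!/(besselK _ _); field.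
move=> H.
have {}H : h^-1 *: (besselK a (h + x) - besselK a x) @[h --> 0^'] -->
    - (besselK (a + 1) x + besselK (a - 1) x) / 2.
  apply: H => //.
  - by rewrite /= in_itv/=; lra.
  - by move=> y; rewrite /= in_itv/= => /andP[y1 _]; apply: kint; lra.
  - by move=> t; rewrite mulr_ge0// addr_ge0// ltW// besselK_kernel_gt0.
  - by apply: (integrableZl _ _ (kD a (x / 2) _)) => //; lra.
  - move=> y t; rewrite /= !in_itv/= => /andP[y1 _] _.
    rewrite dkE normrM normrN (@gtr0_norm _ 2^-1) ?invr_gt0//.
    rewrite ler_pM2l ?invr_gt0//.
    rewrite ger0_norm; last by rewrite addr_ge0// ltW// besselK_kernel_gt0.
    by apply: lerD; rewrite /k /besselK_kernel ler_wpM2r ?(ltW (cosh_gt0 _ _))//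
      ler_expR lerN2 ler_wpM2r ?(ltW (cosh_gt0 _ _))// ltW.
apply: DeriveDef.
  apply/cvg_ex; eexists; under eq_fun do rewrite scaler1; exact: H.
by apply/cvg_lim => //; under eq_fun do rewrite scaler1.
Qed.

(** Because cosh t >= 1, moving from 1 to x multiplies the integrand by at
    most exp (1 - x). *)
Lemma besselK_le_expR (R : realType) (a x : R) : 1 <= x ->
  besselK a x <= expR (1 - x) * besselK a 1.
Proof.
move=> x1; have x0 : 0 < x by lra.
have i1 := integrable_besselK_kernel R a 1 ltr01.
rewrite /besselK -RintegralZl//; apply: le_Rintegral => //.
- exact: (integrable_besselK_kernel R a x x0).
- exact: (integrableZl _ _ i1).
move=> t _; rewrite mulrA ler_wpM2r ?(ltW (cosh_gt0 _ _))// -expRD ler_expR.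
have := cosh_ge1 R t; nra.
Qed.

(** * Comparison for the first-order system *)

(** The recurrence eliminates K_{nu-1}, here, and K_{nu+2}, in the next
    lemma, which leaves a closed first-order system for K_nu and K_{nu+1}. *)
Lemma is_derive_besselK_up (R : realType) (nu x : R) : 0 < x ->
  is_derive x 1 (besselK nu) (nu / x * besselK nu x - besselK (nu + 1) x).
Proof.
move=> x0; have d1 := is_derive_besselK R nu x x0.
apply: is_derive_eq; have := besselK_recurrence R nu x x0 => rec.
have -> : nu / x * besselK nu x = x^-1 * (2 * nu * besselK nu x) / 2.
  by field; rewrite gt_eqF.
rewrite -rec mulKf ?gt_eqF//.
by move: (besselK _ x) (besselK _ x) => u v; field.
Qed.

Lemma is_derive_besselK_down (R : realType) (nu x : R) : 0 < x ->
  is_derive x 1 (besselK (nu + 1))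
    (- besselK nu x - (nu + 1) / x * besselK (nu + 1) x).
Proof.
move=> x0; have d1 := is_derive_besselK R (nu + 1) x x0.
apply: is_derive_eq.
have := besselK_recurrence R (nu + 1) x x0; rewrite addrK => rec.
have -> : (nu + 1) / x * besselK (nu + 1) x =
  x^-1 * (2 * (nu + 1) * besselK (nu + 1) x) / 2 by field; rewrite gt_eqF.
rewrite -rec mulKf ?gt_eqF//.
by move: (besselK _ x) (besselK _ x) => u v; field.
Qed.

Lemma MVT_pos (R : realType) (f df : R -> R) (a b : R) :
  (forall x : R, 0 < x -> is_derive x 1 f (df x)) -> 0 < a -> a < b ->
  exists2 c, a < c < b & f b - f a = df c * (b - a).
Proof.
move=> dfE a0 ab.
have [||c] := @MVT R f df a b ab.
- by move=> x; rewrite in_itv/= => /andP[ax _]; apply: dfE; exact: lt_trans ax.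
- apply: continuous_in_subspaceT => x; rewrite inE/= in_itv/= => /andP[ax _].
  exact: (is_derive_continuous _ _ _ _ (dfE _ (lt_le_trans a0 ax))).
- by rewrite in_itv/=; exists c.
Qed.

(** The positive solution of the system is compared with B, a
    supersolution of the Riccati equation satisfied by x K1 / K, whose defect is
    D.  Here h is the logarithm of the integrating factor of B K - x K1.  The
    last condition says that D has at most one zero, which is enough for strict
    monotonicity. *)
Lemma ratio_gt_supersolution (R : realType) (nu C : R)
    (K K1 B dB h D : R -> R) :
  (forall x : R, 0 < x -> is_derive x 1 K (nu / x * K x - K1 x)) ->
  (forall x : R, 0 < x -> is_derive x 1 K1 (- K x - (nu + 1) / x * K1 x)) ->
  (forall x, 0 < x -> 0 < K x) ->
  (forall x, 0 < x -> 0 < K1 x) ->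
  (forall x, 1 <= x -> K x <= expR (1 - x) * K 1) ->
  0 < C ->
  (forall x : R, 0 < x -> is_derive x 1 B (dB x)) ->
  (forall x : R, 0 < x -> is_derive x 1 h ((B x - nu) / x)) ->
  (forall x, 0 < x -> nu <= B x) ->
  (forall x, 1 <= x -> B x <= C * x) ->
  (forall x, 0 < x ->
     D x = x * dB x - (B x ^+ 2 - 2 * nu * B x - x ^+ 2)) ->
  (forall x, 0 < x -> 0 <= D x) ->
  (forall x y, 0 < x -> x < y -> 0 < D x + D y) ->
  forall x, 0 < x -> B x * K x < x * K1 x.
Proof.
move=> dK dK1 K0 K10 Kexp C0 dBE dhE Bnu BC DE D0 DD.
pose Q x := (B x * K x - x * K1 x) * expR (- h x).
have dQ (x : R) : 0 < x -> is_derive x 1 Q (expR (- h x) * K x * D x / x).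
  move=> x0; have ? := dBE _ x0; have ? := dhE _ x0.
  have ? := dK _ x0; have ? := dK1 _ x0.
  apply: is_derive_eq; rewrite /GRing.scale/= DE//.
  by field; rewrite gt_eqF.
have dQ0 x : 0 < x -> 0 <= expR (- h x) * K x * D x / x.
  move=> x0; rewrite divr_ge0 ?(ltW x0)// mulr_ge0 ?D0//.
  by rewrite mulr_ge0 ?expR_ge0// ltW// K0.
have Qle (x y : R) : 0 < x -> x < y -> Q x <= Q y.
  move=> x0 xy; have [c /andP[xc _] e] := MVT_pos R _ _ x y dQ x0 xy.
  rewrite -subr_ge0 e mulr_ge0 ?dQ0//; [exact: lt_trans xc|lra].
(* D cannot vanish in both halves of [x, y]. *)
have Qlt (x y : R) : 0 < x -> x < y -> Q x < Q y.
  move=> x0 xy; pose m := (x + y) / 2.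
  have xm : x < m by rewrite /m; lra.
  have my : m < y by rewrite /m; lra.
  have m0 : 0 < m by exact: lt_trans xm.
  have [c1 /andP[xc1 c1m] e1] := MVT_pos R _ _ x m dQ x0 xm.
  have [c2 /andP[mc2 c2y] e2] := MVT_pos R _ _ m y dQ m0 my.
  have c10 : 0 < c1 by exact: lt_trans xc1.
  have c20 : 0 < c2 by exact: lt_trans mc2.
  rewrite lt_neqAle Qle// andbT; apply/eqP => Qxy.
  have Qxm := Qle _ _ x0 xm; have Qmy := Qle _ _ m0 my.
  have DQ c a b : 0 < c -> a < b -> Q a = Q b ->
      Q b - Q a = expR (- h c) * K c * D c / c * (b - a) -> D c = 0.
    move=> c0 ab ->; rewrite subrr => /esym/eqP.
    rewrite !mulf_eq0 invr_eq0 (gt_eqF c0) (gt_eqF (expR_gt0 _)).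
    rewrite (gt_eqF (K0 _ c0)).
    by rewrite subr_eq0 (gt_eqF ab) !orbF => /eqP.
  have D1 : D c1 = 0 by apply: (DQ c1 x m) => //; lra.
  have D2 : D c2 = 0 by apply: (DQ c2 m y) => //; lra.
  have := DD c1 c2 c10 (lt_trans c1m mc2); rewrite D1 D2; lra.
have hle y : 1 <= y -> h 1 <= h y.
  rewrite le_eqVlt => /predU1P[->//|y1].
  have [c /andP[c1 _] e] := MVT_pos R _ _ 1 y dhE ltr01 y1.
  have c0 : 0 < c by exact: lt_trans c1.
  by rewrite -subr_ge0 e mulr_ge0 ?divr_ge0 ?subr_ge0 ?Bnu ?(ltW c0) ?(ltW y1).
pose A := C * expR 1 * K 1 * expR (- h 1).
(* From exp y >= y^2 / 2, the decay of K gives Q y = O(1/y). *)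
have Qub y : 1 <= y -> Q y * y <= 2 * A.
  move=> y1; have y0 : 0 < y by lra.
  have ey := expR_gt0 y; have K1gt0 : 0 < K 1 by exact: K0.
  have y2 : y ^+ 2 / expR y <= 2.
    rewrite ler_pdivrMr//; have := @expR_ge1Dxn R y 1 (ltW y0).
    rewrite !factS fact0 !muln1; lra.
  have KE : K y <= expR 1 / expR y * K 1.
    by rewrite -expRB; exact: Kexp.
  have eh : expR (- h y) <= expR (- h 1) by rewrite ler_expR lerN2 hle.
  have Q1 : Q y <= B y * K y * expR (- h y).
    rewrite ler_pM2r ?expR_gt0// lerBlDr lerDl mulr_ge0 ?(ltW y0)// ltW//.
    exact: K10.
  have Q2 : B y * K y * expR (- h y) <=
      C * y * (expR 1 / expR y * K 1) * expR (- h 1).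
    have Cy : 0 <= C * y by rewrite mulr_ge0 ?ltW.
    apply: (@le_trans _ _ (C * y * K y * expR (- h y))).
      by rewrite ler_pM2r ?expR_gt0// ler_pM2r ?K0// BC.
    apply: ler_pM => //; last by rewrite ler_wpM2l.
    exact: mulr_ge0 Cy (ltW (K0 _ y0)).
  apply: (@le_trans _ _ (C * y * (expR 1 / expR y * K 1) * expR (- h 1) * y)).
    by apply: ler_wpM2r; [exact: ltW|exact: le_trans Q1 Q2].
  have -> : C * y * (expR 1 / expR y * K 1) * expR (- h 1) * y =
    y ^+ 2 / expR y * A by rewrite /A; ring.
  by rewrite ler_wpM2r// /A !mulr_ge0 ?expR_ge0// ltW.
have A0 : 0 < A by rewrite /A !mulr_gt0 ?expR_gt0 ?K0.
move=> x x0; rewrite ltNge; apply/negP => Px.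
have Qx : 0 <= Q x by rewrite /Q mulr_ge0 ?expR_ge0// subr_ge0.
have x1 : 0 < x + 1 by lra.
have Qx1 : 0 < Q (x + 1) by apply: le_lt_trans Qx _; apply: Qlt => //; lra.
(* At this y the bound Q y * y <= 2 * A is already violated. *)
pose y := x + 1 + 2 * A / Q (x + 1).
have xy : x + 1 < y by rewrite /y ltrDl divr_gt0// mulr_gt0.
have := Qub y; have := Qle _ _ x1 xy.
have Qy : Q (x + 1) * y = Q (x + 1) * (x + 1) + 2 * A.
  by rewrite /y; field; rewrite gt_eqF.
move=> le1 le2; have {}le2 : Q y * y <= 2 * A by apply: le2; lra.
have : Q (x + 1) * y <= Q y * y by rewrite ler_pM2r//; lra.
have : 0 < Q (x + 1) * (x + 1) by rewrite mulr_gt0.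
lra.
Qed.

(** * The bounds for K *)

Lemma besselK_supersolution (R : realType) (nu C : R) (B dB h D : R -> R) :
  0 < C ->
  (forall x : R, 0 < x -> is_derive x 1 B (dB x)) ->
  (forall x : R, 0 < x -> is_derive x 1 h ((B x - nu) / x)) ->
  (forall x, 0 < x -> nu <= B x) ->
  (forall x, 1 <= x -> B x <= C * x) ->
  (forall x, 0 < x ->
     D x = x * dB x - (B x ^+ 2 - 2 * nu * B x - x ^+ 2)) ->
  (forall x, 0 < x -> 0 <= D x) ->
  (forall x y, 0 < x -> x < y -> 0 < D x + D y) ->
  forall x, 0 < x -> B x * besselK nu x < x * besselK (nu + 1) x.
Proof.
exact (@ratio_gt_supersolution R nu C (besselK nu) (besselK (nu + 1)) B dB h D
  (is_derive_besselK_up R nu) (is_derive_besselK_down R nu)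
  (besselK_gt0 R nu) (besselK_gt0 R (nu + 1)) (besselK_le_expR R nu)).
Qed.

(** The constant 2 nu has defect x^2 and integrating factor x^nu. *)
Lemma besselK_gt_2nu (R : realType) (nu x : R) : 0 < nu -> 0 < x ->
  2 * nu * besselK nu x < x * besselK (nu + 1) x.
Proof.
move=> nu0; apply: (@besselK_supersolution R nu (2 * nu)
  (fun=> 2 * nu) (fun=> 0) (fun y => nu * ln y) (fun y => y ^+ 2)).
- by lra.
- move=> y y0; have ? := is_derive1_ln y0.
  by apply: is_derive_eq; rewrite /GRing.scale/=; field; rewrite gt_eqF.
- by move=> y _; lra.
- by move=> y y1; nra.
- by move=> y y0; ring.
- by move=> y _; exact: sqr_ge0.
- by move=> y z y0 yz; rewrite addr_gt0// exprn_gt0//; exact: lt_trans yz.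
Qed.

(** With d = nu - l, the antiderivative of (l + s)/x, the logarithm of the
    integrating factor, is nu ln x + s - d ln (s + d), because
    (s - d)(s + d) = c x^2. *)
Lemma besselK_gt_sqrt (R : realType) (nu l m x : R) :
  0 < l -> l < nu -> m ^+ 2 = 2 * l -> 0 < x ->
  (nu + l + Num.sqrt ((nu - l) ^+ 2 +
     (nu - l) / (nu - l + (m - 1) ^+ 2) * x ^+ 2)) * besselK nu x
    < x * besselK (nu + 1) x.
Proof.
move=> l0 lnu m2; move: x.
have d0 : 0 < nu - l by lra.
have nuE : nu = l + (nu - l) by ring.
have lE : l = m ^+ 2 / 2 by rewrite m2; field.
move: (nu - l) d0 nuE => d d0 nuE.
have q0 : 0 <= (m - 1) ^+ 2 by exact: sqr_ge0.
have dq0 : 0 < d + (m - 1) ^+ 2 by lra.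
set c := d / (d + (m - 1) ^+ 2).
have c0 : 0 < c by rewrite divr_gt0.
have c1 : c <= 1 by rewrite ler_pdivrMr// mul1r lerDl.
pose s (x : R) := Num.sqrt (d ^+ 2 + c * x ^+ 2).
have sarg0 (x : R) : 0 < d ^+ 2 + c * x ^+ 2.
  by rewrite ltr_pwDl ?exprn_gt0// mulr_ge0 ?sqr_ge0// ltW.
have s2 (x : R) : s x ^+ 2 = d ^+ 2 + c * x ^+ 2 by rewrite sqr_sqrtr// ltW.
have s0 (x : R) : 0 < s x by rewrite sqrtr_gt0.
have ds (x : R) : 0 < x -> is_derive x 1 s (c * x / s x).
  move=> x0; have d1 := is_derive1_sqrt (sarg0 x).
  have d2 : is_derive x 1 (fun y => d ^+ 2 + c * y ^+ 2) (c * (2 * x)).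
    by apply: is_derive_eq; rewrite /GRing.scale/=; ring.
  have -> : c * x / s x = (2 * s x)^-1 * (c * (2 * x)).
    by field; rewrite gt_eqF.
  exact: (@is_derive1_comp R Num.sqrt (fun y => d ^+ 2 + c * y ^+ 2)).
have s_mono (x y : R) : 0 < x -> x < y -> s x < s y.
  move=> x0 xy; rewrite ltr_sqrt// ltrD2l ltr_pM2l// ltr_pXn2r// nnegrE ltW//.
  exact: lt_trans xy.
have sd (x : R) : 0 < x -> d < s x.
  move=> x0; rewrite -(ltr_pXn2r (n := 2))// ?nnegrE ?ltW// s2.
  by rewrite ltrDl mulr_gt0// exprn_gt0.
(* Expressing x through s makes the defect a rational function of s. *)
have x2 (x : R) : x ^+ 2 = (s x ^+ 2 - d ^+ 2) * (d + (m - 1) ^+ 2) / d.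
  by rewrite s2 /c; field; rewrite !gt_eqF.
pose D (x : R) := (s x - d) * (1 - (m - 1) * (s x / d)) ^+ 2 * (d / s x).
have D0 (w : R) : 0 < w -> 0 <= D w.
  move=> w0; apply: mulr_ge0; last by apply: divr_ge0; exact: ltW.
  by apply: mulr_ge0; [rewrite subr_ge0 ltW// sd|exact: sqr_ge0].
have Dgt0 (w : R) : 0 < w -> 1 != (m - 1) * (s w / d) -> 0 < D w.
  move=> w0 ne; apply: mulr_gt0; last exact: divr_gt0.
  apply: mulr_gt0; first by rewrite subr_gt0 sd.
  by rewrite exprn_even_gt0//= subr_eq0.
apply: (@besselK_supersolution R nu (nu + l + d + 1) (fun y => nu + l + s y)
  (fun y => c * y / s y) (fun y => nu * ln y + s y - d * ln (s y + d)) D).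
- by lra.
- move=> y y0; have ? := ds _ y0.
  by apply: is_derive_eq; ring.
- move=> y y0; have ? := ds _ y0; have ? := is_derive1_ln y0.
  have sd0 : 0 < s y + d by rewrite addr_gt0.
  have d1 := is_derive1_ln sd0.
  have d2 : is_derive y 1 (fun z => s z + d) (c * y / s y).
    by apply: is_derive_eq; rewrite addr0.
  have d3 : is_derive y 1 (fun z => ln (s z + d)) _ :=
    @is_derive1_comp R (@ln R) (fun z => s z + d) y _ _ d1 d2.
  apply: is_derive_eq; rewrite /GRing.scale/=.
  have cE : c = (s y - d) * (s y + d) / y ^+ 2.
    have := s2 y => e; rewrite -subr_sqr e; field; rewrite gt_eqF//.
  have sy := s0 y; rewrite cE; move: (s y) sy sd0 => u u0 ud0.
  by rewrite nuE; field; rewrite !gt_eqF.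
- by move=> y _; have := s0 y; lra.
- move=> y y1; have sy : s y <= (d + 1) * y.
    rewrite -(ler_pXn2r (n := 2))// ?nnegrE ?ltW ?mulr_gt0//; try lra.
    rewrite s2 exprMn.
    have y2 : 1 <= y ^+ 2 by rewrite exprn_ege1.
    have cy : c * y ^+ 2 <= y ^+ 2 by rewrite ler_piMl// sqr_ge0.
    have dy : d ^+ 2 <= d ^+ 2 * y ^+ 2 by rewrite ler_peMr// sqr_ge0.
    have : 0 < d * y ^+ 2 by rewrite mulr_gt0//; lra.
    have -> : (d + 1) ^+ 2 * y ^+ 2 =
        d ^+ 2 * y ^+ 2 + 2 * (d * y ^+ 2) + y ^+ 2.
      by ring.
    lra.
  have : nu + l <= (nu + l) * y by rewrite ler_peMr//; lra.
  lra.
- move=> y y0; have sy := s0 y.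
  have -> : y * (c * y / s y) = (c * y ^+ 2) / s y by field; rewrite gt_eqF.
  have -> : c * y ^+ 2 = s y ^+ 2 - d ^+ 2 by rewrite s2; ring.
  rewrite [X in _ - X](_ : _ = (nu + l + s y) ^+ 2 - 2 * nu * (nu + l + s y)
     - (s y ^+ 2 - d ^+ 2) * (d + (m - 1) ^+ 2) / d); last by rewrite -x2.
  rewrite /D nuE lE; move: (s y) sy => u u0.
  by field; rewrite !gt_eqF.
- exact: D0.
- move=> y z y0 yz; have z0 : 0 < z by exact: lt_trans yz.
  have [e1|ne] := eqVneq 1 ((m - 1) * (s y / d)); last first.
    by rewrite ltr_pwDl ?D0 ?Dgt0.
  have ne2 : 1 != (m - 1) * (s z / d).
    apply/eqP => e2; move: (e1); rewrite [X in X = _ -> _]e2.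
    have mN0 : m - 1 != 0.
      by apply: contra_eq_neq e1 => ->; rewrite mul0r oner_eq0.
    move=> /(mulfI mN0) /(mulIf (invr_neq0 (lt0r_neq0 d0))) szy.
    by have := s_mono _ _ y0 yz; rewrite szy ltxx.
  by rewrite ltr_wpDl ?D0 ?Dgt0.
Qed.

Theorem theorem9 (R : realType) (lambda nu x : R)
    (hlambda : 1 / 2 <= lambda <= 2) (hnu : lambda <= nu)
    (hne : (lambda, nu) <> (1 / 2, 1 / 2)) (hx : 0 < x) :
  ratio_bound (nu + lambda) (nu - lambda)
    (Num.sqrt (besselK_coef nu lambda)) x
  < besselK (nu + 1) x / besselK nu x.
Proof.
have K0 := besselK_gt0 R nu x hx.
have l0 : 0 < lambda by lra.
rewrite /ratio_bound ltr_pdivlMr// mulrAC ltr_pdivrMr// [ltRHS]mulrC.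
move: hnu; rewrite le_eqVlt => /predU1P[<-|lnu].
  have -> : besselK_coef lambda lambda = 0 by rewrite /besselK_coef subrr mul0r.
  rewrite subrr sqrtr0 !expr0n/= mul0r addr0 sqrtr0 addr0.
  rewrite (_ : lambda + lambda = 2 * lambda); last by ring.
  exact: besselK_gt_2nu.
pose m := Num.sqrt (2 * lambda).
have m2 : m ^+ 2 = 2 * lambda by rewrite sqr_sqrtr//; lra.
have d0 : 0 < nu - lambda by lra.
have coefE : besselK_coef nu lambda =
    (nu - lambda) / (nu - lambda + (m - 1) ^+ 2).
  rewrite /besselK_coef -/m; congr (_ / _).
  by rewrite sqrrB1 m2 mulr2n; ring.
have coef0 : 0 <= besselK_coef nu lambda.
  rewrite coefE; apply: divr_ge0; first exact: ltW.
  by apply: addr_ge0; [exact: ltW|exact: sqr_ge0].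
rewrite sqr_sqrtr// coefE.
exact: (besselK_gt_sqrt R nu lambda m x l0 lnu m2 hx).
Qed.
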